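(* Let $\{x_k\}_{k\ge0}$, $\{\bar x_{k+1}\}_{k\ge0}$, $\{\alpha_k\}_{k\ge0}$ be generated by the inexact SQA algorithm described in the context, with the line search parameters in the indicated ranges. Then for all $k\ge0$: (i) if LS1 is used, $F(x_{k+1})-F(x_k)\le\gamma\alpha_kQ_k(\bar x_{k+1})$; (ii) if LS2, LS3 or LS4 is used, $F(x_{k+1})-F(x_k)\le\alpha_kQ_k(\bar x_{k+1})$.
   Context: Setting. $\mathcal{H}$ is a real Hilbert space with norm $\|\cdot\|$ and inner product $\langle\cdot,\cdot\rangle$. $F:=f+g$, where $f,g:\mathcal{H}\to(-\infty,\infty]$ are proper lower semicontinuous convex functions with $\operatorname{dom} g\subset\operatorname{int}(\operatorname{dom} f)$ (so $\operatorname{dom}F=\operatorname{dom}g$). $f$ is Fréchet differentiable on an open set containing $\operatorname{dom} g$, and $\nabla f$ is continuous on $\operatorname{dom} g$. The set $\mathcal{X}$ of minimizers of $F$ is nonempty and $F^\ast:=\min F\in\mathbb{R}$. Metrics. $H_k:\mathcal{H}\to\mathcal{H}$ ($k\ge0$) are positive self-adjoint operators, $\langle\cdot,\cdot\rangle_k=\langle\cdot,H_k\cdot\rangle$ are inner products with induced norms $\|\cdot\|_k$, and there are constants $m,M>0$ with $m\|\cdot\|^2\le\|\cdot\|_k^2\le M\|\cdot\|^2$ for all $k\ge0$. Algorithm (inexact SQA). Fix $\eta\in(0,1]$, $x_0\in\operatorname{dom}F$, and one of the line searches below. For $k=0,1,2,\dots$, let $Q_k(x):=\langle\nabla f(x_k),x-x_k\rangle+g(x)-g(x_k)+\frac12\|x-x_k\|_k^2$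 and $Q_k^\ast:=\min_{x\in\mathcal{H}}Q_k(x)$. Choose any $\bar x_{k+1}$ with $Q_k(\bar x_{k+1})\le\eta\,(Q_k^\ast-Q_k(x_k))$ (note $Q_k(x_k)=0$), put $d_k:=\bar x_{k+1}-x_k$, determine $\alpha_k$ by the line search, and set $x_{k+1}:=x_k+\alpha_k d_k$. Line searches. In each case $\beta\in(0,1)$, $\bar\alpha\in(0,1]$, and $\alpha_k$ is the largest $\alpha\in\{\bar\alpha\beta^i: i=0,1,2,\dots\}$ satisfying: LS1 ($\gamma\in(0,1)$): $F(x_k+\alpha d_k)-F(x_k)\le\gamma\alpha\big(\langle\nabla f(x_k),d_k\rangle+g(\bar x_{k+1})-g(x_k)\big)$. LS2 ($\gamma\in(0,m/2)$): $\alpha\|\nabla f(x_k+\alpha d_k)-\nabla f(x_k)\|\le\gamma\|\alpha d_k\|$. LS3 ($\gamma\in(0,1)$): $F(x_k+\alpha d_k)-F(x_k)\le\alpha\big(\langle\nabla f(x_k),d_k\rangle+g(\bar x_{k+1})-g(x_k)+\frac{\gamma}{2}\|d_k\|_k^2\big)$. LS4 ($\gamma\in(0,1)$): $f(x_k+\alpha d_k)-f(x_k)\le\alpha\big(\langle\nabla f(x_k),d_k\rangle+\frac{\gamma}{2}\|d_k\|_k^2\big)$. *)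

(* Defs.v *)
From HB Require Import structures.
From mathcomp Require Import all_boot all_order all_algebra.
From mathcomp Require Import all_classical all_reals all_analysis.
Import Order.TTheory GRing.Theory Num.Theory.
Import numFieldNormedType.Exports.

Set Implicit Arguments.
Unset Strict Implicit.
Unset Printing Implicit Defensive.

Local Open Scope classical_set_scope.
Local Open Scope ring_scope.
Local Open Scope ereal_scope.

Section extended_functions.
Context {R : realType}.

Definition edom {T : Type} (f : T -> \bar R) : set T := [set x | f x < +oo].

Definition eproper {T : Type} (f : T -> \bar R) : Prop :=
  (forall x, -oo < f x) /\ edom f !=set0.

Definition minimizers {T : Type} (f : T -> \bar R) : set T :=
  [set z | forall y, f z <= f y].

(* The minimum of f is attained and equals c. *)
Definition is_minimum {T : Type} (f : T -> \bar R) (c : \bar R) : Prop :=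
  exists2 z, minimizers f z & f z = c.

(* With the convention 0 * +oo = 0, the endpoints t = 0 and t = 1 are
   harmless. *)
Definition econvex {V : lmodType R} (f : V -> \bar R) : Prop :=
  forall (x y : V) (t : R), (0 <= t <= 1)%R ->
    f (t *: x + (1 - t) *: y)%R <= t%:E * f x + (1 - t)%:E * f y.

End extended_functions.

Section hilbert.
Context {R : realType} {H : completeNormedModType R}.

(* The norm of the Banach space H is the one induced by ip, so that (H, ip) is
   a real Hilbert space. *)
Definition hilbert (ip : {dot H for idfun}) : Prop :=
  forall x : H, (`|x| ^+ 2 = ip x x)%R.

Definition is_gradient (ip : {dot H for idfun}) (f : H -> \bar R) (x v : H)
    : Prop :=
  [/\ \forall y \near x, f y \is a fin_num,
      differentiable (fine \o f : H -> R^o) x &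
      forall h : H, ('d (fine \o f : H -> R^o) x h = ip v h)%R].

Definition self_adjoint (ip : {dot H for idfun}) (A : {linear H -> H}) : Prop :=
  forall x y : H, (ip (A x) y = ip x (A y))%R.

Definition positive_op (ip : {dot H for idfun}) (A : {linear H -> H}) : Prop :=
  forall x : H, (0 <= ip x (A x))%R.

Definition norm_of (ip : {dot H for idfun}) (A : {linear H -> H}) (x : H) : R :=
  Num.sqrt (ip x (A x)).

End hilbert.

Inductive line_search := LS1 | LS2 | LS3 | LS4.

Definition gamma_range {R : realType} (ls : line_search) (m gamma : R) : Prop :=
  match ls with
  | LS2 => (0 < gamma < m / 2)%R
  | _ => (0 < gamma < 1)%R
  end.

Section sqa.
Context {R : realType} {H : completeNormedModType R}.
Variables (ip : {dot H for idfun}) (f g : H -> \bar R) (gradf : H -> H).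

(* The model Q_k, for A = H_k and xk = x_k. *)
Definition model (A : {linear H -> H}) (xk x : H) : \bar R :=
  (ip (gradf xk) (x - xk)%R)%:E + g x - g xk
    + (2^-1 * norm_of ip A (x - xk)%R ^+ 2)%:E.

Definition ls_cond (ls : line_search) (gamma : R) (A : {linear H -> H})
    (xk xbar : H) (alpha : R) : Prop :=
  let F := f \+ g in
  let d := (xbar - xk)%R in
  let xalpha := (xk + alpha *: d)%R in
  match ls with
  | LS1 => F xalpha - F xk <=
      (gamma * alpha)%:E * ((ip (gradf xk) d)%:E + g xbar - g xk)
  | LS2 => (alpha * `|gradf xalpha - gradf xk| <= gamma * `|alpha *: d|)%R
  | LS3 => F xalpha - F xk <=
      alpha%:E * ((ip (gradf xk) d)%:E + g xbar - g xk
                  + (gamma / 2 * norm_of ip A d ^+ 2)%:E)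
  | LS4 => f xalpha - f xk <=
      alpha%:E * ((ip (gradf xk) d)%:E
                  + (gamma / 2 * norm_of ip A d ^+ 2)%:E)
  end.

Definition is_largest_step (abar beta : R) (P : R -> Prop) (alpha : R) : Prop :=
  let S := [set (abar * beta ^+ i)%R | i in [set: nat]] in
  [/\ S alpha, P alpha & forall a, S a -> P a -> (a <= alpha)%R].

(* The iterates are those of a run of the method in which every line search
   succeeds; the value xbar 0 plays no role. *)
Record sqa_run (ls : line_search) (eta gamma abar beta : R)
    (A : nat -> {linear H -> H}) (x xbar : nat -> H) (alpha : nat -> R)
    : Prop := SqaRun {
  sqa_init : edom (f \+ g) (x 0%N);
  sqa_inexact : forall k, exists2 Qstar,
    is_minimum (model (A k) (x k)) Qstar &
    model (A k) (x k) (xbar k.+1)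
      <= eta%:E * (Qstar - model (A k) (x k) (x k));
  sqa_step : forall k,
    is_largest_step abar beta
      (ls_cond ls gamma (A k) (x k) (xbar k.+1)) (alpha k);
  sqa_update : forall k,
    x k.+1 = (x k + alpha k *: (xbar k.+1 - x k))%R }.

End sqa.

(* Main.v *)
Require Import Defs.
From HB Require Import structures.
From mathcomp Require Import all_boot all_order all_algebra.
From mathcomp Require Import all_classical all_reals all_analysis.
From mathcomp Require Import lra.
Import Order.TTheory GRing.Theory Num.Theory.
Import numFieldNormedType.Exports.
Local Open Scope classical_set_scope.
Local Open Scope ring_scope.
Local Open Scope ereal_scope.

(** Write [d] for [xbar - x], [D] for [<gradf x, d> + g xbar - g x] and [N] for
   the squared norm of [d] in the current metric, so that the model at [xbar]
   is [D + N / 2].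

   Feasibility comes first, because it is what makes all the function values
   finite. The model vanishes at the current iterate, so its minimum is
   nonpositive, the inexactness condition makes the model at [xbar] nonpositive,
   and hence [g xbar] is finite ([inexact_step_edom]). As the step length lies
   in (0, 1], convexity of [g] keeps the next iterate in [edom g], and
   [sqa_iterates_edom] follows by induction.

   For LS1 and LS3 the search condition is already the claim, up to
   [D <= D + N / 2] and [gamma <= 1]. LS4 and LS2 only control the smooth part:
   they give [f x' - f x <= alpha (<gradf x, d> + N / 2)], and convexity of [g]
   bounds [g x' - g x] by [alpha (g xbar - g x)] ([composite_decrease]).
   For LS4 the bound on [f] is the search condition. For LS2 it comes from the
   gradient inequality at the new point [x'], which gives
   [f x' - f x <= alpha <gradf x', d>]; replacing [gradf x'] by [gradf x] costs
   at most [alpha gamma |d|^2], by Cauchy-Schwarz and the search condition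
   ([gradient_step_decrease]), and [gamma < m / 2] turns this into [N / 2]. *)

Set Implicit Arguments.
Unset Strict Implicit.

Lemma eproper_fin_num (R : realType) (T : Type) (f : T -> \bar R) (x : T) :
  eproper f -> edom f x -> f x \is a fin_num.
Proof. by move=> [fNy _] fx; rewrite fin_numE gt_eqF ?lt_eqF. Qed.

Lemma edomD (R : realType) (T : Type) (f g : T -> \bar R) (x : T) :
  eproper f -> eproper g -> edom (f \+ g) x -> edom f x /\ edom g x.
Proof.
move=> [fNy _] [gNy _]; rewrite /edom /=.
by move: (fNy x) (gNy x); case: (f x) (g x) => [a||] [b||] //=; rewrite ?ltry.
Qed.

Lemma econvex_segment (R : realType) (V : lmodType R) (f : V -> \bar R)
    (x d : V) (t : R) : econvex f -> (0 <= t <= 1)%R ->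
  f (x + t *: d)%R <= t%:E * f (x + d)%R + (1 - t)%:E * f x.
Proof.
move=> cf t01; have := cf (x + d)%R x t t01.
suff -> : (t *: (x + d) + (1 - t) *: x = x + t *: d)%R by [].
by rewrite scalerDr scalerBl scale1r addrC addrA subrK.
Qed.

Lemma econvex_edom (R : realType) (V : lmodType R) (f : V -> \bar R)
    (x d : V) (t : R) : eproper f -> econvex f -> (0 <= t <= 1)%R ->
  edom f x -> edom f (x + d)%R -> edom f (x + t *: d)%R.
Proof.
move=> pf cf t01 fx fxd; have := econvex_segment x d cf t01.
move/le_lt_trans; apply.
rewrite -(fineK (eproper_fin_num pf fx)) -(fineK (eproper_fin_num pf fxd)).
by rewrite -!EFinM -EFinD ltry.
Qed.

Lemma econvex_fine_segment (R : realType) (V : lmodType R) (f : V -> \bar R)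
    (x d : V) (t : R) : eproper f -> econvex f -> (0 <= t <= 1)%R ->
  edom f x -> edom f (x + d)%R ->
  (fine (f (x + t *: d)) - fine (f x) <= t * (fine (f (x + d)) - fine (f x)))%R.
Proof.
move=> pf cf t01 fx fxd; have := econvex_segment x d cf t01.
have fxtd := econvex_edom pf cf t01 fx fxd.
rewrite -(fineK (eproper_fin_num pf fx)) -(fineK (eproper_fin_num pf fxd)).
rewrite -(fineK (eproper_fin_num pf fxtd)).
by rewrite -!EFinM -EFinD lee_fin /=; lra.
Qed.

(** Convexity bounds the difference quotients of [f] at [x] along [d], for steps
   in (0, 1), by the increment [f (x + d) - f x]. The derivative is their limit
   from the right. *)
Lemma gradient_inequality (R : realType) (H : completeNormedModType R)
    (ip : {dot H for idfun}) (f : H -> \bar R) (x d v : H) :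
  eproper f -> econvex f -> edom f x -> edom f (x + d)%R ->
  is_gradient ip f x v ->
  (ip v d <= fine (f (x + d)) - fine (f x))%R.
Proof.
move=> pf cf fx fxd [_ df dfE].
rewrite -dfE -deriveE //.
have cvgq : (h^-1 *: ((fine \o f \o shift x) (h *: d)%R - (fine \o f) x) : R^o)%R
    @[h --> 0^'+] --> 'D_d (fine \o f : H -> R^o) x.
  apply: cvg_trans (@diff_derivable _ _ _ (fine \o f : H -> R^o) x d df).
  apply: cvg_app; apply: within_subset.
  by move=> h /= h0; rewrite gt_eqF.
apply: (cvgr_to_le cvgq).
near=> h.
have h0 : (0 < h)%R by near: h; exact: nbhs_right_gt.
have h1 : (h < 1)%R by near: h; exact: nbhs_right_lt.
rewrite /= [(h *: d + x)%R]addrC.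
rewrite -(ler_pM2l h0) mulrA mulfV ?gt_eqF // mul1r.
by apply: econvex_fine_segment => //; rewrite !ltW.
Unshelve. all: by end_near. Qed.

(** Since the norm is the one induced by [ip], squaring the triangle inequality
   for [u + v] leaves exactly the inequality between the cross terms. *)
Lemma cauchy_schwarz (R : realType) (H : completeNormedModType R)
    (ip : {dot H for idfun}) (u v : H) : hilbert ip ->
  (ip u v <= `|u| * `|v|)%R.
Proof.
move=> hip; have : (`|u + v| ^+ 2 <= (`|u| + `|v|) ^+ 2)%R.
  by rewrite ler_pXn2r ?nnegrE ?addr_ge0 // ler_normD.
have ipC : ip v u = ip u v by rewrite hermC /= expr0 mul1r.
have ipD : ip (u + v)%R (u + v)%R = (ip u u + ip u v + (ip u v + ip v v))%R.
  have ipDl w : ip (u + v)%R w = (ip u w + ip v w)%R by exact: linearDl.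
  have ipDr w : ip w (u + v)%R = (ip w u + ip w v)%R by exact: linearDr.
  by rewrite ipDl !ipDr ipC.
by rewrite sqrrD !hip ipD; lra.
Qed.

Lemma largest_step_range (R : realType) (abar beta a : R) (P : R -> Prop) :
  (0 < abar <= 1)%R -> (0 < beta < 1)%R -> is_largest_step abar beta P a ->
  (0 < a <= 1)%R.
Proof.
move=> /andP[abar0 abar1] /andP[beta0 beta1] [[i _ <-] _ _].
by rewrite mulr_gt0 ?exprn_gt0 //= mulr_ile1 ?exprn_ile1 ?exprn_ge0 // ltW.
Qed.

Lemma model_self (R : realType) (H : completeNormedModType R)
    (ip : {dot H for idfun}) (g : H -> \bar R) (gradf : H -> H)
    (A : {linear H -> H}) (x : H) : g x \is a fin_num ->
  model ip g gradf A x x = 0.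
Proof.
move=> gx; have ip0 u : ip u 0%R = 0%R by exact: linear0r.
have ip0l u : ip 0%R u = 0%R by exact: linear0l.
rewrite /model /norm_of subrr ip0 ip0l sqrtr0 expr0n mulr0.
by rewrite add0e subee // adde0.
Qed.

Lemma model_finE (R : realType) (H : completeNormedModType R)
    (ip : {dot H for idfun}) (g : H -> \bar R) (gradf : H -> H)
    (A : {linear H -> H}) (x y : H) : g x \is a fin_num -> g y \is a fin_num ->
  model ip g gradf A x y =
  (ip (gradf x) (y - x) + (fine (g y) - fine (g x))
    + 2^-1 * norm_of ip A (y - x) ^+ 2)%:E.
Proof.
by move=> gx gy; rewrite /model -[in LHS](fineK gx) -(fineK gy) -!EFinD /= addrA.
Qed.

(** The minimum of the model is at most its value 0 at [x], so the model at [y]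
   is bounded above by a nonpositive number; this forces [g y] to be finite. *)
Lemma inexact_step_edom (R : realType) (H : completeNormedModType R)
    (ip : {dot H for idfun}) (g : H -> \bar R) (gradf : H -> H)
    (A : {linear H -> H}) (x y : H) (eta : R) (Qstar : \bar R) :
  eproper g -> edom g x -> (0 <= eta)%R ->
  is_minimum (model ip g gradf A x) Qstar ->
  model ip g gradf A x y <= eta%:E * (Qstar - model ip g gradf A x x) ->
  edom g y.
Proof.
move=> pg gx eta0 [z zmin zQ]; have gxfin := eproper_fin_num pg gx.
have := zmin x; rewrite zQ model_self // sube0 => Q0 /le_lt_trans.
have {}Q0 : eta%:E * Qstar <= 0 by rewrite mule_ge0_le0.
move=> /(_ _ (le_lt_trans Q0 (ltry 0))).
rewrite /edom /model /= -(fineK gxfin).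
by case: (g y) => [r _|//|_]; rewrite ?ltry ?ltNyy.
Qed.

(** The gradient inequality is used at the new point, where [v'] is the gradient,
   in the direction [- (a *: d)] back to [x]. The hypothesis on [v' - v] then
   exchanges [v'] for the old gradient [v]. *)
Lemma gradient_step_decrease (R : realType) (H : completeNormedModType R)
    (ip : {dot H for idfun}) (f : H -> \bar R) (x d v v' : H) (a gamma : R) :
  hilbert ip -> eproper f -> econvex f ->
  edom f x -> edom f (x + a *: d)%R ->
  is_gradient ip f (x + a *: d)%R v' ->
  (0 <= a)%R -> (a * `|v' - v| <= gamma * `|a *: d|)%R ->
  (fine (f (x + a *: d)) - fine (f x) <= a * (ip v d + gamma * `|d| ^+ 2))%R.
Proof.
move=> hip pf cf fx fxad grad a0 hgamma.
have := @gradient_inequality _ _ ip f _ (- (a *: d))%R _ pf cf fxad.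
rewrite addrK => /(_ _ fx grad).
rewrite linearNr linearZr_LR /=.
have := cauchy_schwarz (v' - v)%R d hip.
rewrite linearBl /= => /(ler_wpM2l a0).
move: hgamma; rewrite normrZ (ger0_norm a0) => /(ler_wpM2r (normr_ge0 d)).
by rewrite expr2; lra.
Qed.

(** The nonsmooth part needs no search condition: along the segment from [x] to
   [y], convexity makes [g] increase by at most [a] times [g y - g x], which is
   the share of [g] in the model. *)
Lemma composite_decrease (R : realType) (H : completeNormedModType R)
    (ip : {dot H for idfun}) (f g : H -> \bar R) (gradf : H -> H)
    (A : {linear H -> H}) (x y : H) (a : R) :
  eproper f -> eproper g -> econvex g -> edom g x -> edom g y ->
  edom f x -> edom f (x + a *: (y - x))%R -> (0 <= a <= 1)%R ->
  (fine (f (x + a *: (y - x))) - fine (f x)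
     <= a * (ip (gradf x) (y - x) + 2^-1 * norm_of ip A (y - x) ^+ 2))%R ->
  (f \+ g) (x + a *: (y - x))%R - (f \+ g) x <=
    a%:E * model ip g gradf A x y.
Proof.
move=> pf pg cg gx gy fx fxa a01 fdec.
have yE : (x + (y - x))%R = y by rewrite addrC subrK.
have gy' : edom g (x + (y - x))%R by rewrite yE.
have gxa := econvex_edom pg cg a01 gx gy'.
have := econvex_fine_segment pg cg a01 gx gy'.
rewrite model_finE ?eproper_fin_num //= yE.
rewrite -(fineK (eproper_fin_num pf fx)) -(fineK (eproper_fin_num pf fxa)).
rewrite -(fineK (eproper_fin_num pg gx)) -(fineK (eproper_fin_num pg gxa)).
rewrite -!EFinM -!EFinD lee_fin /=.
by move: fdec; lra.
Qed.

(** The two memberships are proved together because [x k.+1] lies on the segment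
   from [x k] to [xbar k.+1]. *)
Lemma sqa_iterates_edom (R : realType) (H : completeNormedModType R)
    (ip : {dot H for idfun}) (f g : H -> \bar R) (gradf : H -> H)
    (A : nat -> {linear H -> H}) (ls : line_search) (eta gamma abar beta : R)
    (x xbar : nat -> H) (alpha : nat -> R) (k : nat) :
  eproper f -> eproper g -> econvex g ->
  (0 <= eta)%R -> (0 < abar <= 1)%R -> (0 < beta < 1)%R ->
  sqa_run ip f g gradf ls eta gamma abar beta A x xbar alpha ->
  edom g (x k) /\ edom g (xbar k.+1).
Proof.
move=> pf pg cg eta0 abar01 beta01 run.
have xbarP j : edom g (x j) -> edom g (xbar j.+1).
  move=> gx; have [Q Qmin Qle] := sqa_inexact run j.
  exact: inexact_step_edom Qmin Qle.
suff gx : edom g (x k) by split=> //; exact: xbarP.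
elim: k => [|k gx]; first by case: (edomD pf pg (sqa_init run)).
rewrite (sqa_update run); apply: econvex_edom => //.
  by case/andP: (largest_step_range abar01 beta01 (sqa_step run k)) => /ltW -> ->.
by rewrite addrC subrK; exact: xbarP.
Qed.

Lemma le_model (R : realType) (H : completeNormedModType R)
    (ip : {dot H for idfun}) (g : H -> \bar R) (gradf : H -> H)
    (A : {linear H -> H}) (x y : H) :
  (ip (gradf x) (y - x))%:E + g y - g x <= model ip g gradf A x y.
Proof. by rewrite /model leeDl // lee_fin mulr_ge0 ?invr_ge0 ?sqr_ge0. Qed.

Theorem lemma2 (R : realType) (H : completeNormedModType R)
  (ip : {dot H for idfun}) (f g : H -> \bar R) (gradf : H -> H)
  (A : nat -> {linear H -> H}) (m M : R)
  (ls : line_search) (eta gamma abar beta : R)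
  (x xbar : nat -> H) (alpha : nat -> R)
  (hilbertH : hilbert ip)
  (proper_f : eproper f) (lsc_f : lower_semicontinuous f) (convex_f : econvex f)
  (proper_g : eproper g) (lsc_g : lower_semicontinuous g) (convex_g : econvex g)
  (dom_gf : edom g `<=` interior (edom f))
  (gradient_f : exists U : set H, [/\ open U, edom g `<=` U &
     forall y, U y -> is_gradient ip f y (gradf y)])
  (continuous_gradf : {within edom g, continuous gradf})
  (minimizers_F : minimizers (f \+ g) !=set0)
  (min_F : exists Fstar : R, is_minimum (f \+ g) Fstar%:E)
  (A_self_adjoint : forall k, self_adjoint ip (A k))
  (A_positive : forall k, positive_op ip (A k))
  (m_gt0 : (0 < m)%R) (M_gt0 : (0 < M)%R)
  (A_bounds : forall k (u : H),
     (m * `|u| ^+ 2 <= norm_of ip (A k) u ^+ 2 <= M * `|u| ^+ 2)%R)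
  (eta_range : (0 < eta <= 1)%R)
  (beta_range : (0 < beta < 1)%R)
  (abar_range : (0 < abar <= 1)%R)
  (gamma_in_range : gamma_range ls m gamma)
  (run : sqa_run ip f g gradf ls eta gamma abar beta A x xbar alpha) :
  forall k : nat,
    (ls = LS1 ->
       (f \+ g) (x k.+1) - (f \+ g) (x k) <=
       (gamma * alpha k)%:E * model ip g gradf (A k) (x k) (xbar k.+1)) /\
    (ls = LS2 \/ ls = LS3 \/ ls = LS4 ->
       (f \+ g) (x k.+1) - (f \+ g) (x k) <=
       (alpha k)%:E * model ip g gradf (A k) (x k) (xbar k.+1)).
Proof.
move=> k.
have gf : edom g `<=` edom f by move=> y /dom_gf /interior_subset.
have eta0 : (0 <= eta)%R by case/andP: eta_range => /ltW.
have iterates j := sqa_iterates_edom j proper_f proper_g convex_g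
  eta0 abar_range beta_range run.
have [gx gxbar] := iterates k; have [gx1 _] := iterates k.+1.
have [_ step _] := sqa_step run k.
have /andP[a0 a1] := largest_step_range abar_range beta_range (sqa_step run k).
have a01 : (0 <= alpha k <= 1)%R by rewrite ltW.
have xE := sqa_update run k.
rewrite xE in gx1 *.
have fx := gf _ gx; have fx1 := gf _ gx1.
have gamma0 : (0 < gamma)%R by move: gamma_in_range; case: (ls) => /= /andP[].
have norm0 : (0 <= norm_of ip (A k) (xbar k.+1 - x k) ^+ 2)%R by rewrite sqr_ge0.
split=> [lsE|lsE].
  move: step; rewrite lsE /= => /le_trans; apply.
  by apply: lee_wpmul2l; [rewrite lee_fin mulr_ge0 // ltW|exact: le_model].
case: lsE gamma_in_range step => [->|[->|->]] /= /andP[_ gamma1] step.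
- have [U [_ gU gradU]] := gradient_f.
  apply: composite_decrease => //.
  have grad1 := gradU _ (gU _ gx1).
  apply: le_trans (gradient_step_decrease _ _ _ _ _ grad1 (ltW a0) step) _ => //.
  rewrite ler_wpM2l ?(ltW a0) // lerD2l.
  have /andP[mn _] := A_bounds k (xbar k.+1 - x k)%R.
  have := sqr_ge0 `|xbar k.+1 - x k|%R; by nra.
- apply: le_trans step _; rewrite lee_wpmul2l ?lee_fin ?(ltW a0) //.
  by rewrite /model leeD2l // lee_fin; nra.
- apply: composite_decrease => //.
  move: step; rewrite -(fineK (eproper_fin_num proper_f fx)).
  rewrite -(fineK (eproper_fin_num proper_f fx1)) -!EFinD -EFinM lee_fin /=.
  move=> /le_trans; apply; rewrite ler_wpM2l ?(ltW a0) // lerD2l; nra.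
Qed.
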